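(* Let $S^{(1)}(n)$ denote the number of secondary structures of rank $1$ on $n$ vertices. Then the sequence $(S^{(1)}(n))_{n\geq 0}$ is log-convex, i.e. $S^{(1)}(n)^2 \le S^{(1)}(n-1)\,S^{(1)}(n+1)$ for all $n\ge 1$.
   Context: For $n\ge 0$, a secondary structure of rank $1$ on the vertex set $[n]=\{1,\dots,n\}$ is a set of arcs, each arc being a pair $\{i,j\}$ with $i<j$ and $j-i>1$, such that no vertex belongs to two arcs and no two arcs cross (there are no arcs $\{i,j\},\{k,l\}$ with $i<k<j<l$); nested arcs are allowed. (Equivalently it is a planar graph on $[n]$ consisting of the segments $[i,i+1]$ together with such arcs drawn in the upper half-plane.) $S^{(1)}(n)$ is the number of such structures; in particular $S^{(1)}(0)=S^{(1)}(1)=S^{(1)}(2)=1$, $S^{(1)}(3)=2$. A sequence $(a_n)$ of positive reals is log-convex if $a_n^2\le a_{n-1}a_{n+1}$ for all $n\ge1$. *)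

(* Defs.v *)
From mathcomp Require Import all_boot all_order all_algebra.
From mathcomp Require Import reals.

Set Implicit Arguments.
Unset Strict Implicit.
Unset Printing Implicit Defensive.

Import Order.TTheory GRing.Theory Num.Theory.

(* The vertices 1, ..., n are represented by the elements 0, ..., n - 1 of
   'I_n, and an arc {i, j} with i < j by the ordered pair (i, j). *)
Definition arc_on n (a : 'I_n * 'I_n) (v : 'I_n) : bool :=
  (v == a.1) || (v == a.2).

Definition crosses n (a b : 'I_n * 'I_n) : bool :=
  (a.1 < b.1) && (b.1 < a.2) && (a.2 < b.2).

Definition secondary_structure n (A : {set 'I_n * 'I_n}) : bool :=
  [&& [forall a in A, (a.1 < a.2) && (1 < a.2 - a.1)],
      [forall v : 'I_n, #|[set a in A | arc_on a v]| <= 1] &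
      [forall a in A, forall b in A, ~~ crosses a b]].

Definition S1 (n : nat) : nat :=
  #|[set A : {set 'I_n * 'I_n} | secondary_structure A]|.

Definition log_convex (R : realType) (a : nat -> R) : Prop :=
  (forall n : nat, (0 < a n)%R) /\
  (forall n : nat, 1 <= n -> (a n ^+ 2 <= a n.-1 * a n.+1)%R).

(* Main.v *)
Require Import Defs.
From mathcomp Require Import all_boot all_order all_algebra.
From mathcomp Require Import reals.
From mathcomp Require Import zify ring lra.

(* Looking at the arc ending at the last vertex gives
   S(n+1) = S(n) + sum_(i+1 < n) S(i) S(n-1-i), that is,
   x^2 S^2 - (1 - x + x^2) S + 1 = 0 for the generating function. Hence
   T = 1 - x + x^2 - 2 x^2 S satisfies T^2 = D with D a quartic polynomial, so
   2 D T' = D' T, which is the linear recurrence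
   (n+2) S(n) = (2n+1) S(n-1) + (n-1) S(n-2) + (2n-5) S(n-3) - (n-4) S(n-4).
   With a = (3 + sqrt 5) / 2 and b(n) = 2 n a / (2 n + 3), this recurrence
   propagates the interlacing b(n) <= S(n) / S(n-1) <= b(n+1), valid for n >= 6,
   so the ratios S(n) / S(n-1) increase. *)

Set Implicit Arguments.
Unset Strict Implicit.
Unset Printing Implicit Defensive.

(** * Structures as families of compatible arcs, confined to an interval *)

Definition compatible n (a b : 'I_n * 'I_n) : bool :=
  [|| a.2 < b.1, b.2 < a.1, (a.1 < b.1) && (b.2 < a.2) |
      (b.1 < a.1) && (a.2 < b.2)].

(** For arcs with ordered ends, sharing no vertex and not crossing amounts to lying side by side or
    strictly nested. The cardinality condition thus becomes a pairwise one, in inequalities that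
    suit [lia]. *)
Lemma secondary_structureP n (A : {set 'I_n * 'I_n}) :
  reflect ((forall a : 'I_n * 'I_n, a \in A -> a.1.+1 < a.2) /\
           (forall a b : 'I_n * 'I_n, a \in A -> b \in A -> a != b -> compatible a b))
          (secondary_structure A).
Proof.
apply: (iffP and3P) => [[/forall_inP len /forallP deg /forall_inP cr]|[len cmp]].
  have {}len a : a \in A -> a.1.+1 < a.2 by move/len; lia.
  split=> // a b aA bA ab.
  have disj v : arc_on a v -> arc_on b v -> False.
    move=> av bv; move/card_le1_eqP: (deg v) => /(_ a b).
    by rewrite !inE aA bA av bv => /(_ isT isT) eab; rewrite eab eqxx in ab.
  have n11 : val a.1 != val b.1.
    apply/eqP => /val_inj e; apply: (disj a.1).
      by rewrite /arc_on eqxx.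
    by rewrite /arc_on e eqxx.
  have n12 : val a.1 != val b.2.
    apply/eqP => /val_inj e; apply: (disj a.1).
      by rewrite /arc_on eqxx.
    by rewrite /arc_on e eqxx orbT.
  have n21 : val a.2 != val b.1.
    apply/eqP => /val_inj e; apply: (disj a.2).
      by rewrite /arc_on eqxx orbT.
    by rewrite /arc_on e eqxx.
  have n22 : val a.2 != val b.2.
    apply/eqP => /val_inj e; apply: (disj a.2).
      by rewrite /arc_on eqxx orbT.
    by rewrite /arc_on e eqxx orbT.
  move/forall_inP: (cr _ aA) => /(_ _ bA); move/forall_inP: (cr _ bA) => /(_ _ aA).
  move: (len _ aA) (len _ bA); rewrite /crosses /compatible /= in n11 n12 n21 n22 *.
  lia.
split.
- by apply/forall_inP => -[a1 a2] /len /=; lia.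
- apply/forallP => v; apply/card_le1_eqP => b a; rewrite !inE.
  move=> /andP[bA bv] /andP[aA av]; apply/eqP; apply: contraT => ab.
  move: (cmp _ _ aA bA ab) (len _ aA) (len _ bA); rewrite /compatible.
  by case/orP: av bv => /eqP -> /orP[] /eqP /(congr1 val) /=; lia.
- apply/forall_inP => a aA; apply/forall_inP => b bA.
  have [->|ab] := eqVneq a b; first by rewrite /crosses; lia.
  by move: (cmp _ _ aA bA ab) (len _ aA) (len _ bA); rewrite /compatible /crosses; lia.
Qed.

(** The vertices allowed are those from [l] to [r - 1]. Keeping the ambient type ['I_n] lets the
    pieces of a structure be cut out and united without relabelling. *)
Definition structures_within n (l r : nat) : {set {set 'I_n * 'I_n}} :=
  [set A | secondary_structure A & [forall a in A, (l <= a.1) && (a.2 < r)]].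

Lemma structures_withinP n l r (A : {set 'I_n * 'I_n}) :
  reflect [/\ forall a : 'I_n * 'I_n, a \in A -> a.1.+1 < a.2,
              forall a b : 'I_n * 'I_n, a \in A -> b \in A -> a != b -> compatible a b &
              forall a : 'I_n * 'I_n, a \in A -> l <= a.1 /\ a.2 < r]
          (A \in structures_within n l r).
Proof.
rewrite inE; apply: (iffP andP).
  move=> [/secondary_structureP[len cmp] /forall_inP lr]; split=> // a /lr.
  by case/andP.
move=> [len cmp lr]; split; first exact/secondary_structureP.
by apply/forall_inP => a /lr [-> ->].
Qed.

(** Since [r] is the last vertex allowed, every other arc lies left of [j] or strictly under
    [(j, r)]. The two families are independent, hence the product. *)
Lemma card_structures_with_arc n l (j r : 'I_n) :
  #|[set A in structures_within n l r.+1 | (j, r) \in A]| =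
  if (l <= j) && (j.+1 < r)
  then #|structures_within n l j| * #|structures_within n j.+1 r| else 0.
Proof.
case: ifP => [/andP[lj jr]|ljr]; last first.
  apply/eqP; rewrite cards_eq0; apply/eqP/setP => A; rewrite in_set0.
  apply/negP => /setIdP[/structures_withinP[len _ lr] jrA].
  by move: (len _ jrA) (lr _ jrA) => /=; lia.
rewrite -cardsX.
(* [f] glues the two families along the arc and [g] cuts a structure apart; what is left is that the
   image of [f] is exactly the set counted. *)
pose f (p : {set 'I_n * 'I_n} * {set 'I_n * 'I_n}) := (j, r) |: (p.1 :|: p.2).
pose g (A : {set 'I_n * 'I_n}) :=
  ([set a in A | a.2 < j], [set a in A | (j < a.1) && (a.2 < r)]).
have fK : {in setX (structures_within n l j) (structures_within n j.+1 r),
           cancel f g}.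
  move=> [B C] /setXP[/= /structures_withinP[lenB _ inB]].
  move=> /structures_withinP[lenC _ inC].
  congr pair; apply/setP => a; rewrite !inE /=.
    have [->|_ /=] := eqVneq a (j, r).
      by rewrite /=; apply/idP/idP => [|/inB /=]; lia.
    case: (boolP (a \in B)) => [/inB [] //|_ /=].
    by case: a => a1 a2; apply/negbTE/negP => /andP[/[dup] /inC + /lenC] => /=; lia.
  have [->|_ /=] := eqVneq a (j, r).
    by rewrite /=; apply/idP/idP => [|/inC /=]; lia.
  case: (boolP (a \in C)) => [/inC [-> ->]|_]; first by rewrite orbT.
  by rewrite orbF; case: a => a1 a2; apply/negbTE/negP => /andP[/[dup] /inB + /lenB] => /=; lia.
rewrite -(card_in_imset (can_in_inj fK)); apply: eq_card => A.
apply/idP/imsetP => [/setIdP[/structures_withinP[len cmp lr] jrA]|].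
  have cases a : a \in A -> [|| a == (j, r), a.2 < j | (j < a.1) && (a.2 < r)].
    move=> aA; have [//|/=] := eqVneq a (j, r) => /(cmp _ _ aA jrA).
    by move: (lr _ aA) (len _ aA); rewrite /compatible /=; lia.
  exists (g A); last first.
    apply/setP => a; rewrite !inE /=; apply/idP/idP => [/[dup] aA /cases|].
      by rewrite aA.
    by case/or3P => [/eqP ->//|/andP[]//|/andP[]//].
  rewrite in_setX; apply/andP; split; apply/structures_withinP; split=> /=.
  - by move=> a /setIdP[/len].
  - by move=> a b /setIdP[aA _] /setIdP[bA _]; apply: cmp.
  - by move=> a /setIdP[/lr[]].
  - by move=> a /setIdP[/len].
  - by move=> a b /setIdP[aA _] /setIdP[bA _]; apply: cmp.
  - by move=> a /setIdP[_ /andP[]].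
case=> -[B C] /setXP[/= /structures_withinP[lenB cmpB inB]].
move=> /structures_withinP[lenC cmpC inC] ->.
rewrite inE; apply/andP; split; last by rewrite !inE eqxx.
have fE (a : 'I_n * 'I_n) : a \in f (B, C) -> [\/ a = (j, r), a \in B | a \in C].
  rewrite !inE => /or3P[/eqP ->||]; [exact: Or31|exact: Or32|exact: Or33].
apply/structures_withinP; split.
- by move=> a /fE[->//|/lenB|/lenC].
- rewrite /compatible => a b /fE[->|aB|aC] /fE[->|bB|bC] /=; rewrite ?eqxx //.
  + by move: (inB _ bB) (lenB _ bB); lia.
  + by move: (inC _ bC) (lenC _ bC); lia.
  + by move: (inB _ aB) (lenB _ aB); lia.
  + exact: cmpB.
  + by move: (inB _ aB) (lenB _ aB) (inC _ bC) (lenC _ bC); lia.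
  + by move: (inC _ aC) (lenC _ aC); lia.
  + by move: (inC _ aC) (lenC _ aC) (inB _ bB) (lenB _ bB); lia.
  + exact: cmpC.
- by move=> a /fE[->|/inB|/inC] /=; lia.
Qed.

(* Either no arc ends at the last vertex [r], or exactly one arc [(j, r)] does. *)
Lemma card_structures_withinS n l (r : 'I_n) :
  #|structures_within n l r.+1| =
  #|structures_within n l r| +
  \sum_(j < n | (l <= j) && (j.+1 < r))
     #|structures_within n l j| * #|structures_within n j.+1 r|.
Proof.
rewrite big_mkcond /=; under eq_bigr do rewrite -card_structures_with_arc.
rewrite -sum1_card (bigID [pred A | A \in structures_within n l r]) /=; congr (_ + _).
  rewrite -sum1_card; apply: eq_bigl => A; rewrite andbC.
  case: (boolP (A \in structures_within n l r)) => // /structures_withinP[len cmp lr].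
  by apply/structures_withinP; split=> // a /lr; lia.
(* After exchanging the sums, [A] contributes the number of [j] with [(j, r) \in A]: one if [A]
   reaches the vertex [r], none otherwise. *)
under [RHS]eq_bigr => j _ do rewrite -sum1dep_card big_mkcondr /=.
rewrite exchange_big /= big_mkcondr /=; apply: eq_bigr => A AS.
have /structures_withinP[len cmp lr] := AS.
rewrite -big_mkcond /= sum1dep_card; case: ifP => [nA|/negbFE].
  have /existsP[j jrA] : [exists j, (j, r) \in A].
    apply: contraR nA => /existsPn nA; apply/structures_withinP; split=> // a aA.
    have [al] := lr _ aA; rewrite ltnS leq_eqVlt => /orP[/eqP/val_inj e|]; last by [].
    by case/negP: (nA a.1); rewrite -e -surjective_pairing.
  apply/esym/eqP/cards1P; exists j; apply/setP => k; rewrite !inE.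
  apply/idP/eqP => [krA|->//]; apply/eqP; apply: contraT => kj.
  have /(cmp _ _ krA jrA) : (k, r) != (j, r) by rewrite xpair_eqE (negPf kj).
  by move: (len _ krA) (len _ jrA); rewrite /compatible /=; lia.
move=> /structures_withinP[_ _ lr']; apply/esym/eqP; rewrite cards_eq0.
apply/eqP/setP => j; rewrite in_set0 inE; apply/negP => /lr' /=; lia.
Qed.

(** * Dependence on the length alone and the convolution recurrence *)

Lemma structures_within_empty n l : structures_within n l l = [set set0].
Proof.
apply/setP => A; rewrite in_set1; apply/structures_withinP/eqP => [[len _ lr]|->].
  by apply/setP => a; rewrite in_set0; apply/negP => /[dup] /len + /lr; lia.
by split=> [a|a b|a]; rewrite in_set0.
Qed.

Lemma S1E n : S1 n = #|structures_within n 0 n|.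
Proof.
apply: eq_card => A; rewrite !inE; case: (secondary_structure A) => //=.
by apply/esym/forall_inP => a _; rewrite ltn_ord.
Qed.

Lemma card_structures_within_addS n l d : l + d < n ->
  #|structures_within n l (l + d).+1| =
  #|structures_within n l (l + d)| +
  \sum_(i < d | i.+1 < d)
     #|structures_within n l (l + i)| *
     #|structures_within n (l + i).+1 ((l + i).+1 + (d - i.+1))|.
Proof.
move=> ldn; rewrite -[l + d]/(val (Ordinal ldn)) card_structures_withinS /=.
congr (_ + _).
rewrite -(big_mkord (fun j => (l <= j) && (j.+1 < l + d))
   (fun j => #|structures_within n l j| * #|structures_within n j.+1 (l + d)|)).
rewrite -(big_mkord (fun i => i.+1 < d) (fun i => #|structures_within n l (l + i)| *
     #|structures_within n (l + i).+1 ((l + i).+1 + (d - i.+1))|)).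
rewrite (big_cat_nat (n := l)) //=; last by lia.
rewrite big_nat_cond big_pred0 ?add0n; last by move=> i; lia.
rewrite (big_cat_nat (n := l + d)) //=; [|lia..].
rewrite [X in _ + X]big_nat_cond [X in _ + X]big_pred0 ?addn0; last by move=> i; lia.
rewrite -{1}[l]add0n [l + d]addnC big_addn addnK.
rewrite big_nat_cond [RHS]big_nat_cond; apply: eq_big => [i|i /andP[/andP[_ ltid] _]]; first lia.
by congr (#|structures_within _ _ _| * #|structures_within _ _ _|); lia.
Qed.

(** Both counts obey the same recurrence in the length [d], so strong induction replaces an explicit
    translation of arcs. *)
Lemma eq_card_structures_within d n l n' l' : l + d <= n -> l' + d <= n' ->
  #|structures_within n l (l + d)| = #|structures_within n' l' (l' + d)|.
Proof.
elim/ltn_ind: d n l n' l' => -[|d] IH n l n' l' le le'.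
  by rewrite !addn0 !structures_within_empty !cards1.
rewrite !addnS !card_structures_within_addS; [|lia..].
congr (_ + _); first by apply: IH; lia.
by apply: eq_bigr => i lid; congr (_ * _); apply: IH; lia.
Qed.

Lemma card_structures_within n l d :
  l + d <= n -> #|structures_within n l (l + d)| = S1 d.
Proof.
move=> ldn; rewrite S1E.
exact: (@eq_card_structures_within d n l d 0 ldn (leqnn _)).
Qed.

Lemma S1S n : S1 n.+1 = S1 n + \sum_(i < n | i.+1 < n) S1 i * S1 (n - i.+1).
Proof.
have := @card_structures_within_addS n.+1 0 n (leqnn _).
rewrite [in LHS]add0n -S1E card_structures_within // => ->; congr (_ + _).
by apply: eq_bigr => i lin; rewrite !card_structures_within //; lia.
Qed.

Lemma S1_0 : S1 0 = 1.
Proof. by rewrite S1E structures_within_empty cards1. Qed.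

(** The added [S1 n] is the term [i = n], which would come from an arc between adjacent vertices;
    with it the sum is a full Cauchy product. *)
Lemma S1SS n : S1 n.+2 + S1 n = S1 n.+1 + \sum_(i < n.+1) S1 i * S1 (n - i).
Proof.
rewrite S1S -addnA; congr (_ + _); rewrite [RHS]big_ord_recr /= subnn S1_0 muln1.
congr (_ + _); rewrite big_mkcond big_ord_recr /= ltnn addn0.
by apply: eq_bigr => i _; rewrite ltnS ltn_ord subSS.
Qed.

(** * Generating function and linear recurrence *)

Import Order.TTheory GRing.Theory Num.Theory.
Local Open Scope ring_scope.

(** A truncation stands in for the power series; identities are read only on coefficients that the
    truncation leaves intact. *)
Definition S1_poly (R : comNzRingType) N : {poly R} := \poly_(i < N) (S1 i)%:R.

Lemma coef_S1_functional_eq (R : comNzRingType) N k : (k < N)%N ->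
  ('X^2 * S1_poly R N ^+ 2 - (1 - 'X + 'X^2) * S1_poly R N + 1)`_k = 0.
Proof.
move=> kN; have PE i : (i <= k)%N -> (S1_poly R N)`_i = (S1 i)%:R.
  by move=> ik; rewrite coef_poly (leq_ltn_trans ik kN).
rewrite !mulrDl mul1r mulNr -['X]expr1 !(coefD, coefN, coefXnM) expr2 coef1.
case: k kN PE => [|[|k]] kN PE /=; rewrite ?subn0 ?subn1 ?subn2 /= ?PE //; last by lia.
- by rewrite S1_0; ring.
- by rewrite S1S big_ord0 addn0; ring.
rewrite coefM (eq_bigr (fun i : 'I_k.+1 => (S1 i * S1 (k - i))%:R)); last first.
  by move=> i _; rewrite natrM !PE //; have := ltn_ord i; lia.
rewrite -natr_sum; have := congr1 (fun m => m%:R : R) (S1SS k).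
by rewrite !natrD => /(canRL (addrK _)) ->; ring.
Qed.

Lemma coefM_eq0 (R : nzRingType) (p q : {poly R}) N k :
  (forall i, (i < N)%N -> p`_i = 0) -> (k < N)%N -> (p * q)`_k = 0.
Proof.
move=> p0 kN; rewrite coefM big1 // => i _.
by rewrite p0 ?mul0r // (leq_ltn_trans _ kN) // -ltnS.
Qed.

(** Multiplying the derivative of [T * T = D] by [T] gives [2 D T' = D' T]. With an error [W], the
    defect involves only multiples of [W] and [W'], so it vanishes to low orders when [W] does. *)
Lemma square_deriv_rel (R : comNzRingType) (T D W : {poly R}) : T * T = D + W ->
  D * T^`() *+ 2 - D^`() * T = W^`() * T - W * (T^`() *+ 2).
Proof. by move=> /esym/(canRL (addrK _)) ->; rewrite derivB derivM; ring. Qed.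

Lemma S1_holonomic (R : numDomainType) d :
  (d%:R + 6) * (S1 (d + 4))%:R =
  (2 * d%:R + 9) * (S1 (d + 3))%:R + (d%:R + 3) * (S1 (d + 2))%:R +
  (2 * d%:R + 3) * (S1 (d + 1))%:R - d%:R * (S1 d)%:R :> R.
Proof.
(* [T] is the square root [1 - x + x^2 - 2 x^2 S] of the discriminant [D] of the
   functional equation, up to the truncation error [W]. *)
pose N := (d + 5)%N; pose P := S1_poly R N.
pose T := 1 - 'X + 'X^2 - 'X^2 * P *+ 2.
pose D : {poly R} := 1 - 'X *+ 2 - 'X^2 - 'X^3 *+ 2 + 'X^4.
pose W := ('X^2 * ('X^2 * P ^+ 2 - (1 - 'X + 'X^2) * P + 1)) *+ 4.
have TE : T * T = D + W by rewrite /T /D /W; ring.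
have W0 i : (i < N.+2)%N -> W`_i = 0.
  move=> iN; rewrite coefMn coefXnM; case: ltnP => [_|i2]; first by rewrite mul0rn.
  by rewrite coef_S1_functional_eq ?mul0rn //; lia.
have W'0 i : (i < N.+1)%N -> W^`()`_i = 0 by move=> iN; rewrite coef_deriv W0 ?mul0rn.
(* Index [d + 5] equals [N], still within the range of [W'0]. There [T'] brings in the coefficient
   of [T] at [d + 6], hence [S1 (d + 4)]. *)
have key : (D * T^`() *+ 2 - D^`() * T)`_(d + 5) = 0.
  rewrite (square_deriv_rel TE).
  by rewrite coefB (coefM_eq0 _ W'0) // (coefM_eq0 _ W0) ?subrr.
have TS i : (i + 1 < N)%N -> T`_(i + 3) = - (S1 (i + 1))%:R *+ 2.
  move=> iN; rewrite /T -['X]expr1 !(coefD, coefN, coefMn, coefXnM, coefXn, coef1).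
  rewrite coef_poly !addn3 /= !subSS subn0 -addn1 iN.
  by rewrite addn1 /=; ring.
(* The ['X^2] of [1 - 'X + 'X^2] reaches this coefficient only for [d = 0]. In [key] the coefficient
   is multiplied by [2 d], so the indicator drops out through [d0]. *)
have T2 : T`_(d + 2) = (d == 0%N)%:R - (S1 d)%:R *+ 2.
  rewrite /T -['X]expr1 !(coefD, coefN, coefMn, coefXnM, coefXn, coef1).
  have dN : (d < N)%N by rewrite /N; lia.
  by rewrite coef_poly !addn2 /= !subSS !subn0 dN !eqSS; ring.
have DE : D^`() = - 2 - 'X *+ 2 - 'X^2 *+ 6 + 'X^3 *+ 4.
  by rewrite /D !derivE /=; ring.
clearbody T; move: key; rewrite DE /D.
rewrite (_ : _ - _ = T^`() *+ 2 - 'X^1 * T^`() *+ 4 - 'X^2 * T^`() *+ 2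
  - 'X^3 * T^`() *+ 4 + 'X^4 * T^`() *+ 2
  + T *+ 2 + 'X^1 * T *+ 2 + 'X^2 * T *+ 6 - 'X^3 * T *+ 4); last by ring.
rewrite !(coefD, coefN, coefMn, coefXnM, coef_deriv) !addnS !addn0 /= !subSS !subn0.
have T3 i : (i + 1 < N)%N -> T`_i.+3 = - (S1 i.+1)%:R *+ 2 by move/TS; rewrite addn3 addn1.
rewrite addn2 in T2.
rewrite !T3 ?T2 /N; [|lia..].
have d0 : 2 * (d%:R * (d == 0%N)%:R) = 0 :> R by case: (d) => [|d']; rewrite !(mul0r, mulr0).
have combine (x y u v : R) : u = 0 -> v = 0 -> x - y = v - u -> x = y.
  by move=> -> ->; rewrite subr0 => /eqP; rewrite subr_eq0 => /eqP.
have n4 : 4 != 0 :> R by rewrite pnatr_eq0.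
move=> e; apply: (mulfI n4); apply: (combine _ _ _ _ e d0).
do ![set s := (S1 _)%:R; move: s => s]; set z := (d == 0%N)%:R; move: z => z.
ring.
Qed.

(** * Growth rate and inequalities for the inductive step *)

Definition golden_sq (R : rcfType) : R := (3 + Num.sqrt 5) / 2.

(** The discriminant factors as (1 - 3x + x^2)(1 + x + x^2). By this relation its root of least
    modulus is the inverse of [golden_sq], which is therefore the growth rate of [S1]. *)
Lemma golden_sqE (R : rcfType) : golden_sq R ^+ 2 = 3 * golden_sq R - 1.
Proof.
have := @sqr_sqrtr R 5 (ler0n _ 5); rewrite /golden_sq; set s := Num.sqrt 5 => s2.
by apply/eqP; rewrite -subr_eq0; apply/eqP; transitivity ((s ^+ 2 - 5) / 4); [field|rewrite s2; field].
Qed.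

Lemma golden_sq_bounds (R : rcfType) : 1309 / 500 <= golden_sq R <= 2619 / 1000.
Proof.
have := golden_sqE R; set a := golden_sq R => a2.
(* This selects the larger root of the quadratic, the other one being below 1. *)
have a1 : 3 / 2 <= a by rewrite /a /golden_sq; have := sqrtr_ge0 (5 : R); lra.
apply/andP; split; nra.
Qed.

(* The ratio [S1 n / S1 (n - 1)] behaves like [golden_sq * (1 - 3 / (2 n))]. *)
Definition ratio_bound (R : rcfType) (x : R) : R :=
  golden_sq R * (2 * x) / (2 * x + 3).

Lemma mulr_denom_ge0 (R : realFieldType) (d x : R) : 0 < d -> 0 <= d * x -> 0 <= x.
Proof. by move=> d0; rewrite pmulr_rge0. Qed.

(** Lower half of the inductive step, for [x = n] and [s0], ..., [s4] equal to [S1 n], ...,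
    [S1 (n - 4)]. The signs of the coefficients decide which bound each earlier ratio must
    supply. *)
Lemma ratio_step_ge (R : rcfType) (x s0 s1 s2 s3 s4 : R) :
  5 <= x ->
  (x + 2) * s0 =
    (2 * x + 1) * s1 + (x - 1) * s2 + (2 * x - 5) * s3 - (x - 4) * s4 ->
  0 <= s4 ->
  s1 <= ratio_bound x * s2 -> s2 <= ratio_bound (x - 1) * s3 ->
  ratio_bound (x - 3) * s4 <= s3 ->
  ratio_bound x * s1 <= s0.
Proof.
move=> xge; have [m m0 xE] : exists2 m, 0 <= m & x = m + 5.
  by exists (x - 5); [rewrite subr_ge0|rewrite subrK].
have a2 := golden_sqE R; have /andP[al au] := golden_sq_bounds R.
set a := golden_sq R in a2 al au; pose b := @ratio_bound R.
have am0 u v k : 0 <= u + v * a -> 0 <= (u + v * a) * m ^+ k.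
  by move=> uv; rewrite mulr_ge0 // exprn_ge0.
(* Eliminating [s1], [s2], [s3] in turn from [(x + 2) s0] by the bounds on
   successive ratios produces the coefficients [A], [B], [C], [D]; cleared of
   denominators and reduced modulo [a2], they have coefficients of constant sign
   as polynomials in [m]. Numerals above 5000 are split because they are elaborated
   through unary naturals. *)
pose A := 2 * x + 1 - (x + 2) * b x.
pose B := A * b x + (x - 1).
pose C := B * b (x - 1) + (2 * x - 5).
pose D := C * b (x - 3) - (x - 4).
have A_sg : 0 <= - A.
  apply: (@mulr_denom_ge0 _ (2 * x + 3)).
    by rewrite ?mulr_gt0 ?exprn_gt0 //; lra.
  rewrite (_ : _ * _ = (- 143 + 70 * a) * m ^+ 0 +
       (- 48 + 24 * a) * m ^+ 1 +
       (- 4 + 2 * a) * m ^+ 2).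
    by rewrite ?addr_ge0 // -?mulNr am0 //; lra.
  by rewrite /A /b /ratio_bound -/a xE; field: a2; lra.
have B_sg : 0 <= - B.
  apply: (@mulr_denom_ge0 _ ((2 * x + 3) ^+ 2)).
    by rewrite ?mulr_gt0 ?exprn_gt0 //; lra.
  rewrite (_ : _ * _ = (- 1376 + 670 * a) * m ^+ 0 +
       (- 757 + 374 * a) * m ^+ 1 +
       (- 136 + 68 * a) * m ^+ 2 +
       (- 8 + 4 * a) * m ^+ 3).
    by rewrite ?addr_ge0 // -?mulNr am0 //; lra.
  by rewrite /B /A /b /ratio_bound -/a xE; field: a2; lra.
have C_sg : 0 <= C.
  apply: (@mulr_denom_ge0 _ ((2 * x + 3) ^+ 2 * (2 * x + 1))).
    by rewrite ?mulr_gt0 ?exprn_gt0 //; lra.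
  rewrite (_ : _ * _ = ((14 * 1000 + 655) - (5 * 1000 + 72) * a) * m ^+ 0 +
       ((12 * 1000 + 600) - 4188 * a) * m ^+ 1 +
       (3852 - 1274 * a) * m ^+ 2 +
       (504 - 168 * a) * m ^+ 3 +
       (24 - 8 * a) * m ^+ 4).
    by rewrite ?addr_ge0 // -?mulNr am0 //; lra.
  by rewrite /C /B /A /b /ratio_bound -/a xE; field: a2; lra.
have D_sg : 0 <= D.
  apply: (@mulr_denom_ge0 _ ((2 * x + 3) ^+ 2 * (2 * x + 1) * (2 * x - 3))).
    by rewrite ?mulr_gt0 ?exprn_gt0 //; lra.
  rewrite (_ : _ * _ = ((7 * 1000 + 275) - 2244 * a) * m ^+ 0 +
       (3795 - 978 * a) * m ^+ 1 +
       (528 + 192 * a) * m ^+ 2 +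
       (12 + 60 * a) * m ^+ 3).
    by rewrite ?addr_ge0 // -?mulNr am0 //; lra.
  by rewrite /D /C /B /A /b /ratio_bound -/a xE; field: a2; lra.
rewrite -!/(b _) => rec s4_ge0 h1 h2 h3.
rewrite -subr_ge0; apply: (@mulr_denom_ge0 _ (x + 2)); first lra.
(* The sum telescopes: each slack in a hypothesis is weighted by a coefficient of known sign. *)
rewrite (_ : _ * _ = - A * (b x * s2 - s1) + - B * (b (x - 1) * s3 - s2) +
   C * (s3 - b (x - 3) * s4) + D * s4).
  by rewrite !addr_ge0 // mulr_ge0 // subr_ge0.
by rewrite mulrBr rec /D /C /B /A; ring.
Qed.

(** Upper half of the step, by the same elimination. The target inequality is reversed, so the first
    two ratios are bounded below, the third above, and the last coefficient [D] must be
    nonpositive. *)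
Lemma ratio_step_le (R : rcfType) (x s0 s1 s2 s3 s4 : R) :
  6 <= x ->
  (x + 2) * s0 =
    (2 * x + 1) * s1 + (x - 1) * s2 + (2 * x - 5) * s3 - (x - 4) * s4 ->
  0 <= s4 ->
  ratio_bound (x - 1) * s2 <= s1 -> ratio_bound (x - 2) * s3 <= s2 ->
  s3 <= ratio_bound (x - 2) * s4 ->
  s0 <= ratio_bound (x + 1) * s1.
Proof.
move=> xge; have [m m0 xE] : exists2 m, 0 <= m & x = m + 6.
  by exists (x - 6); [rewrite subr_ge0|rewrite subrK].
have a2 := golden_sqE R; have /andP[al au] := golden_sq_bounds R.
set a := golden_sq R in a2 al au; pose b := @ratio_bound R.
have am0 u v k : 0 <= u + v * a -> 0 <= (u + v * a) * m ^+ k.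
  by move=> uv; rewrite mulr_ge0 // exprn_ge0.
pose A := 2 * x + 1 - (x + 2) * b (x + 1).
pose B := A * b (x - 1) + (x - 1).
pose C := B * b (x - 2) + (2 * x - 5).
pose D := C * b (x - 2) - (x - 4).
have A_sg : 0 <= - A.
  apply: (@mulr_denom_ge0 _ (2 * x + 5)).
    by rewrite ?mulr_gt0 ?exprn_gt0 //; lra.
  rewrite (_ : _ * _ = (- 221 + 112 * a) * m ^+ 0 +
       (- 60 + 30 * a) * m ^+ 1 +
       (- 4 + 2 * a) * m ^+ 2).
    by rewrite ?addr_ge0 // -?mulNr am0 //; lra.
  by rewrite /A /b /ratio_bound -/a xE; field: a2; lra.
have B_sg : 0 <= - B.
  apply: (@mulr_denom_ge0 _ ((2 * x + 5) * (2 * x + 1))).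
    by rewrite ?mulr_gt0 ?exprn_gt0 //; lra.
  rewrite (_ : _ * _ = (- 2225 + 1150 * a) * m ^+ 0 +
       (- 1045 + 530 * a) * m ^+ 1 +
       (- 160 + 80 * a) * m ^+ 2 +
       (- 8 + 4 * a) * m ^+ 3).
    by rewrite ?addr_ge0 // -?mulNr am0 //; lra.
  by rewrite /B /A /b /ratio_bound -/a xE; field: a2; lra.
have C_sg : 0 <= C.
  apply: (@mulr_denom_ge0 _ ((2 * x + 5) * (2 * x + 1) * (2 * x - 1))).
    by rewrite ?mulr_gt0 ?exprn_gt0 //; lra.
  rewrite (_ : _ * _ = ((26 * 1000 + 217) - (9 * 1000 + 800) * a) * m ^+ 0 +
       ((19 * 1000 + 116) - (6 * 1000 + 810) * a) * m ^+ 1 +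
       ((5 * 1000 + 52) - 1730 * a) * m ^+ 2 +
       (576 - 192 * a) * m ^+ 3 +
       (24 - 8 * a) * m ^+ 4).
    by rewrite ?addr_ge0 // -?mulNr am0 //; lra.
  by rewrite /C /B /A /b /ratio_bound -/a xE; field: a2; lra.
have D_sg : 0 <= - D.
  apply: (@mulr_denom_ge0 _ ((2 * x + 5) * (2 * x + 1) * (2 * x - 1) ^+ 2)).
    by rewrite ?mulr_gt0 ?exprn_gt0 //; lra.
  rewrite (_ : _ * _ = (- (24 * 1000 + 918) + (25 * 1000 + 464) * a) * m ^+ 0 +
       (- (13 * 1000 + 371) + (16 * 1000 + 878) * a) * m ^+ 1 +
       (- 2460 + 3732 * a) * m ^+ 2 +
       (- 156 + 276 * a) * m ^+ 3).
    by rewrite ?addr_ge0 // -?mulNr am0 //; lra.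
  by rewrite /D /C /B /A /b /ratio_bound -/a xE; field: a2; lra.
rewrite -!/(b _) => rec s4_ge0 h1 h2 h3.
rewrite -subr_ge0; apply: (@mulr_denom_ge0 _ (x + 2)); first lra.
rewrite (_ : _ * _ = - A * (s1 - b (x - 1) * s2) + - B * (s2 - b (x - 2) * s3) +
   C * (b (x - 2) * s4 - s3) + - D * s4).
  by rewrite !addr_ge0 // mulr_ge0 // subr_ge0.
by rewrite mulrBr rec /D /C /B /A; ring.
Qed.

(** * Initial values and interlacing of the ratios *)

Lemma S1_small :
  [/\ S1 1 = 1, S1 2 = 1, S1 3 = 2 & S1 4 = 4]%N /\
  [/\ S1 5 = 8, S1 6 = 17, S1 7 = 37 & S1 8 = 82]%N.
Proof.
have e1 : S1 1 = 1%N by rewrite S1S big_ord0 S1_0.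
have e2 : S1 2 = 1%N by rewrite S1S big_mkcond !big_ord_recr big_ord0 /= e1.
have e3 : S1 3 = 2%N by rewrite S1S big_mkcond !big_ord_recr big_ord0 /= e2 e1 S1_0.
have e4 : S1 4 = 4%N by rewrite S1S big_mkcond !big_ord_recr big_ord0 /= e3 e2 e1 S1_0.
have e5 : S1 5 = 8%N by rewrite S1S big_mkcond !big_ord_recr big_ord0 /= e4 e3 e2 e1 S1_0.
have e6 : S1 6 = 17%N.
  by rewrite S1S big_mkcond !big_ord_recr big_ord0 /= e5 e4 e3 e2 e1 S1_0.
have e7 : S1 7 = 37%N.
  by rewrite S1S big_mkcond !big_ord_recr big_ord0 /= e6 e5 e4 e3 e2 e1 S1_0.
have e8 : S1 8 = 82%N.
  by rewrite S1S big_mkcond !big_ord_recr big_ord0 /= e7 e6 e5 e4 e3 e2 e1 S1_0.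
by [].
Qed.

(** The range starts at 5 because [S1 5 / S1 4 = 2] is below [ratio_bound 5]. *)
Lemma S1_ratio_bounds (R : rcfType) n : (5 <= n)%N ->
  ratio_bound n.+1%:R * (S1 n)%:R <= (S1 n.+1)%:R :> R /\
  (S1 n.+1)%:R <= ratio_bound n.+2%:R * (S1 n)%:R :> R.
Proof.
have [[e1 e2 e3 e4] [e5 e6 e7 e8]] := S1_small.
have /andP[al au] := golden_sq_bounds R.
have b6 : ratio_bound 6 = golden_sq R * (4 / 5) by rewrite /ratio_bound; field.
have b7 : ratio_bound 7 = golden_sq R * (14 / 17) by rewrite /ratio_bound; field.
have b8 : ratio_bound 8 = golden_sq R * (16 / 19) by rewrite /ratio_bound; field.
have b9 : ratio_bound 9 = golden_sq R * (6 / 7) by rewrite /ratio_bound; field.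
elim/ltn_ind: n => n IH n5.
(* The step uses the three preceding ratios, at [n - 3], [n - 2] and [n - 1], so 5, 6 and 7 are base
   cases. *)
have [/eqP->|/eqP->|/eqP->|n8] : [\/ n == 5, n == 6, n == 7 | (8 <= n)%N]%N.
- by move: n5; do 8?[case: n IH => [|n] IH //]; [exact: Or41|exact: Or42|exact: Or43|exact: Or44].
- by rewrite e5 e6 b6 b7; split; lra.
- by rewrite e6 e7 b7 b8; split; lra.
- by rewrite e7 e8 b8 b9; split; lra.
have [m nE] : exists m, n = (m + 3)%N by exists (n - 3)%N; lia.
have := S1_holonomic R m; rewrite {}nE in n8 IH *.
rewrite !addnS !addn0 in n8 IH *.
have [] := IH m.+2; [lia..|]; have [] := IH m.+1; [lia..|]; have [] := IH m; [lia..|].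
have m0 : 5 <= m%:R :> R by rewrite ler_nat; lia.
have s0 : 0 <= (S1 m)%:R :> R by exact: ler0n.
move=> l1 u1 l2 u2 l3 u3 rec; split.
- apply: (ratio_step_ge (s2 := (S1 m.+2)%:R) (s3 := (S1 m.+1)%:R) (s4 := (S1 m)%:R)) => //.
  + by rewrite -!natr1; lra.
  + by move: rec; rewrite -!natr1; lra.
  + by rewrite -natr1 addrK.
  + by rewrite (_ : _ - _ = m.+1%:R) // -!natr1; ring.
- rewrite -[m.+1.+4%:R]natr1.
  apply: (ratio_step_le (s2 := (S1 m.+2)%:R) (s3 := (S1 m.+1)%:R) (s4 := (S1 m)%:R)) => //.
  + by rewrite -!natr1; lra.
  + by move: rec; rewrite -!natr1; lra.
  + by rewrite -natr1 addrK.
  + by rewrite (_ : _ - _ = m.+2%:R) // -!natr1; ring.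
  + by rewrite (_ : _ - _ = m.+2%:R) // -!natr1; ring.
Qed.

(** * Positivity and log-convexity *)

Lemma S1_gt0 n : (0 < S1 n)%N.
Proof. by elim: n => [|n IH]; rewrite ?S1_0 // S1S addn_gt0 IH. Qed.

Theorem theorem4 (R : realType) : log_convex (fun n : nat => (S1 n)%:R%R : R).
Proof.
split=> [n|[//|n] _]; first by rewrite ltr0n S1_gt0.
rewrite -natrX -natrM ler_nat /=.
have [[e1 e2 e3 e4] [e5 e6 _ _]] := S1_small.
case: (ltnP n 5) => [|n5].
  by case: n => [|[|[|[|[|]]]]] // _; rewrite ?S1_0 ?e1 ?e2 ?e3 ?e4 ?e5 ?e6.
rewrite -(ler_nat R) natrX natrM expr2.
(* Consecutive ratios are separated by c = [ratio_bound n.+2]: S(n+1)^2 <= c S(n) S(n+1) <= S(n)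
   S(n+2). *)
have [_ up] := S1_ratio_bounds R n5.
have [lo _] := S1_ratio_bounds R (leqW n5).
have := ler_wpM2r (ler0n R (S1 n.+1)) up; have := ler_wpM2l (ler0n R (S1 n)) lo.
by move=> h1 h2; apply: le_trans h2 (le_trans _ h1); rewrite mulrCA mulrA.
Qed.
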